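(* Let $s\ge 3$. Suppose there is a constant $t>1$ and an $s$-graph $H$ with $r(H)>2$ and $t\,(r(H)-2)\le \xi(H)-2$. Then there is no constant $c$ with $1\le c<t$ such that $\xi(G)\le c\, r(G)$ for all $s$-graphs $G$.
   Context: Graphs are finite, connected, may have multiple edges but no loops. An $s$-graph is an $s$-regular graph $G$ such that $|\partial_G(X)|\ge s$ for every subset $X\subseteq V(G)$ of odd cardinality, where $\partial_G(X)$ is the set of edges joining $X$ to $V(G)\setminus X$. The resistance $r(G)$ is the minimum number of edges that have to be removed from $G$ to obtain a $\Delta(G)$-edge-colorable subgraph. A 2-factorization of a $2n$-regular graph is a decomposition of its edge set into $n$ edge-disjoint 2-factors. For a 2-factorization $\mathcal F$, $o(\mathcal F)$ is the number of odd cycles in the 2-factors of $\mathcal F$. The oddness of an $s$-regular graph $G$ is: $\xi(G)=\min\{o(\mathcal F):\mathcal F \text{ a 2-factorization of } G\}$ if $s$ is even; $\xi(G)=\min\{\xi(G-F_1): F_1 \text{ a 1-factor of } G\}$ if $s$ is odd and $G$ has a 1-factor; and $\xi(G)=\infty$ otherwise. *)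

(* Defs.v *)
From HB Require Import structures.
From mathcomp Require Import all_boot all_order all_algebra.
From mathcomp Require Import constructive_ereal reals.

Set Implicit Arguments.
Unset Strict Implicit.
Unset Printing Implicit Defensive.

Import Order.TTheory GRing.Theory Num.Theory.

(* Finite loopless multigraphs. Connectedness is part of [s_graph] only, since
   deleting a 1-factor or a set of edges may disconnect the graph. *)
Record multigraph := Multigraph {
  vertex : finType;
  edge : finType;
  ends : edge -> {set vertex};
  card_ends : forall e, #|ends e| = 2
}.

Section Multigraph.
Variable G : multigraph.
Implicit Types (C F : {set edge G}) (X : {set vertex G}) (v x y : vertex G).

Definition degree_in C v : nat := #|[set e in C | v \in ends e]|.

Definition degree v : nat := degree_in [set: edge G] v.

Definition max_degree : nat := \max_(v : vertex G) degree v.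

Definition regular (s : nat) : Prop := forall v, degree v = s.

Definition adj_in C : rel (vertex G) :=
  fun x y => [exists e in C, ends e == [set x; y]].

Definition connected : Prop :=
  0 < #|vertex G| /\ forall x y, connect (adj_in [set: edge G]) x y.

Definition edge_cut X : {set edge G} :=
  [set e | (ends e :&: X != set0) && (ends e :&: ~: X != set0)].

Definition edge_colorable (k : nat) : bool :=
  [exists c : {ffun edge G -> 'I_k}, forall e, forall f,
     (e != f) && (ends e :&: ends f != set0) ==> (c e != c f)].

Lemma delete_edges_card F (e : {e : edge G | e \notin F}) :
  #|ends (val e)| = 2.
Proof. exact: card_ends. Qed.

Definition delete_edges F : multigraph :=
  @Multigraph (vertex G) {e : edge G | e \notin F}
    (fun e => ends (val e)) (@delete_edges_card F).

Definition one_factor F : bool := [forall v, degree_in F v == 1].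

Definition two_factor F : bool := [forall v, degree_in F v == 2].

Definition covered C : {set vertex G} := \bigcup_(e in C) ends e.

(* Cycles, as edge sets: nonempty connected 2-regular subgraphs. A pair of
   parallel edges is thus a cycle of length 2. *)
Definition is_cycle C : bool :=
  [&& C != set0,
      [forall v in covered C, degree_in C v == 2]
    & [forall x in covered C, forall y in covered C, connect (adj_in C) x y]].

Definition odd_cycles F : {set {set edge G}} :=
  [set C : {set edge G} | [&& C \subset F, is_cycle C & odd #|C|]].

Definition two_factorization (n : nat) (P : {set {set edge G}}) : bool :=
  [&& partition P [set: edge G], #|P| == n & [forall F in P, two_factor F]].

Definition num_odd_cycles (P : {set {set edge G}}) : nat :=
  \sum_(F in P) #|odd_cycles F|.

End Multigraph.

Definition s_graph (s : nat) (G : multigraph) : Prop :=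
  [/\ connected G, regular G s
    & forall X : {set vertex G}, odd #|X| -> s <= #|edge_cut X|].

(* The minimum ranges over a nonempty family: deleting all edges leaves an
   edge-colorable graph, so the default [setT] of [arg min] is admissible. *)
Definition resistance (G : multigraph) : nat :=
  #|[arg min_(F < [set: edge G] |
        edge_colorable (delete_edges F) (max_degree G)) #|F| ]|.

(* Oddness of a [2 * n]-regular graph; the minimum of an empty family is
   [+oo]. *)
Definition even_oddness (R : realType) (n : nat) (G : multigraph) : \bar R :=
  \big[Order.min/+oo%E]_(P : {set {set edge G}} | two_factorization n P)
    ((num_odd_cycles P)%:R)%:E.

(* Oddness of an [s]-regular graph. For odd [s], [G - F] is [2 * s./2]-regular
   and the value is [+oo] when [G] has no 1-factor. *)
Definition oddness (R : realType) (s : nat) (G : multigraph) : \bar R :=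
  if odd s then
    \big[Order.min/+oo%E]_(F : {set edge G} | one_factor F)
      even_oddness R s./2 (delete_edges F)
  else even_oddness R s./2 G.

(* Main.v *)
(* For edges e1 = u1 v1 of G and e2 = u2 v2 of H, delete e1 and e2 and add the
   edges u1 u2 and v1 v2; the result K is again an s-graph.

   - Resistance: choose e1 in a minimum set of edges whose removal leaves an
     s-edge-colourable graph. Its ends miss different colours a, b (otherwise e1
     could be coloured), and likewise for e2. After permuting the colours of H both
     new edges can be coloured with a and b, so r(K) <= r(G) + r(H) - 2.
   - Oddness: the new edges form a 2-edge cut, so by parity every 1- or 2-factor of
     K contains both or none of them and induces factors of G and of H. Only the
     cycles through e1 and e2 can be new odd cycles, so
     xi(K) >= xi(G) + xi(H) - 2.

   Gluing n + 1 copies of H therefore gives r <= n (r(H) - 2) + r(H) and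
   xi >= n (xi(H) - 2) + xi(H); the ratio of these bounds tends to at least t. The
   assumed bound xi <= c r keeps the resistance positive along the iteration. *)

Require Import Defs.
From mathcomp Require Import all_boot all_order all_algebra.
From mathcomp Require Import all_fingroup.
From mathcomp Require Import constructive_ereal reals.
From mathcomp Require Import zify lra.

Set Implicit Arguments.
Unset Strict Implicit.
Unset Printing Implicit Defensive.

Import Order.TTheory GRing.Theory Num.Theory.

(** * Disjoint unions and preimages of partitions *)

Lemma mem_imset_inl (T1 T2 : finType) (A : {set T1}) (x : T1) :
  (inl x \in [set (inl y : T1 + T2) | y in A]) = (x \in A).
Proof. by rewrite mem_imset // => ? ? []. Qed.

Lemma mem_imset_inr (T1 T2 : finType) (A : {set T2}) (x : T2) :
  (inr x \in [set (inr y : T1 + T2) | y in A]) = (x \in A).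
Proof. by rewrite mem_imset // => ? ? []. Qed.

Lemma inr_notin_imset_inl (T1 T2 : finType) (A : {set T1}) (x : T2) :
  (inr x \in [set (inl y : T1 + T2) | y in A]) = false.
Proof. by apply/imsetP => -[]. Qed.

Lemma inl_notin_imset_inr (T1 T2 : finType) (A : {set T2}) (x : T1) :
  (inl x \in [set (inr y : T1 + T2) | y in A]) = false.
Proof. by apply/imsetP => -[]. Qed.

Lemma card_sum_set (T1 T2 : finType) (A : {set T1 + T2}) :
  #|A| = #|inl @^-1: A| + #|inr @^-1: A|.
Proof.
rewrite -!sum1_card big_sumType /=.
by congr (_ + _); apply: eq_bigl => x; rewrite !inE.
Qed.

(** Distinct blocks have disjoint preimages, so once these are nonempty they are also distinct.
    Injectivity keeps the number of factors unchanged when a factorization is restricted to one side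
    of a 2-sum. *)
Lemma preimset_partition (T T' : finType) (f : T' -> T) (E : {set T})
    (P : {set {set T}}) :
  partition P E -> {in P, forall B : {set T}, f @^-1: B != set0} ->
  partition [set f @^-1: B | B : {set T} in P] (f @^-1: E)
  /\ {in P &, injective (fun B : {set T} => f @^-1: B)}.
Proof.
move=> /and3P[/eqP covE /trivIsetP tI _] nz.
have [||part inj] := @indexed_partition _ _ (mem P) (fun B : {set T} => f @^-1: B).
- move=> A B PA PB neq; have := tI _ _ PB PA neq.
  rewrite -!setI_eq0 -preimsetI setIC => /eqP ->.
  by rewrite preimset0.
- by move=> B PB; apply: nz.
split=> //; suff -> : f @^-1: E = cover [set f @^-1: B | B : {set T} in P] by [].
apply/setP => x; rewrite inE -covE; apply/bigcupP/bigcupP => -[B PB xB].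
  by exists (f @^-1: B); [apply: imset_f | rewrite inE].
by case/imsetP: PB xB => A PA ->; rewrite inE; exists A.
Qed.

(** * Edge cuts: parity, bridges and connectedness *)

Lemma ends_pair (G : multigraph) (e : edge G) :
  exists x y, x != y /\ ends e = [set x; y].
Proof. by apply/cards2P; rewrite card_ends. Qed.

Lemma mem_edge_cut (G : multigraph) (e : edge G) x y (X : {set vertex G}) :
  ends e = [set x; y] -> (e \in edge_cut X) = (x \in X) (+) (y \in X).
Proof.
move=> E; rewrite inE E.
have ne (A : {set vertex G}) : ([set x; y] :&: A != set0) = (x \in A) || (y \in A).
  apply/set0Pn/orP => [[z]|[]].
    by rewrite !inE => /andP[/orP[]/eqP-> ->]; [left|right].
  by exists x; rewrite !inE eqxx.
  by exists y; rewrite !inE eqxx orbT.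
by rewrite !ne !inE; do 2!case: (_ \in X).
Qed.

Lemma odd_card_ends_setI (G : multigraph) (e : edge G) (X : {set vertex G}) :
  odd #|ends e :&: X| = (e \in edge_cut X).
Proof.
have [x [y [xy E]]] := ends_pair e.
rewrite (mem_edge_cut X E) E setIUl cardsU.
have c1 z : #|[set z] :&: X| = (z \in X).
  case: (boolP (z \in X)) => zX; first by rewrite (setIidPl _) ?cards1 ?sub1set.
  by apply/eqP; rewrite cards_eq0 setI_eq0 disjoints1.
rewrite !c1 [X in _ - X](_ : _ = 0) ?subn0 ?oddD; last first.
  apply/eqP; rewrite cards_eq0; apply/eqP/setP => z; rewrite !inE.
  by case: eqP => //= ->; rewrite (negPf xy) andbF.
by do 2!case: (_ \in X).
Qed.

Lemma sum_degree_in (G : multigraph) (B : {set edge G}) (X : {set vertex G}) :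
  \sum_(v in X) degree_in B v = \sum_(e in B) #|ends e :&: X|.
Proof.
under eq_bigr do rewrite /degree_in -sum1dep_card big_mkcondr.
rewrite exchange_big; apply: eq_bigr => e _.
by rewrite -big_mkcondr -sum1_card; apply: eq_bigl => v; rewrite !inE andbC.
Qed.

Lemma odd_sum (I : finType) (A : {set I}) (F : I -> nat) :
  odd (\sum_(i in A) F i) = odd #|[set i in A | odd (F i)]|.
Proof.
rewrite -sum1dep_card big_mkcondr /=.
elim/big_rec2: _ => //= i m n _ IH; rewrite !oddD IH.
by case: ifP => // ->.
Qed.

(** An edge has exactly one end in [X] if it lies in the cut, and none or two otherwise, so only cut
    edges of [B] affect the parity. *)
Lemma odd_sum_degree_in (G : multigraph) (B : {set edge G}) (X : {set vertex G}) :
  odd (\sum_(v in X) degree_in B v) = odd #|B :&: edge_cut X|.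
Proof.
rewrite sum_degree_in odd_sum; congr (odd #|pred_of_set _|).
by apply/setP => e; rewrite in_set odd_card_ends_setI in_setI.
Qed.

Lemma odd_edge_cut (G : multigraph) s (X : {set vertex G}) :
  regular G s -> odd #|edge_cut X| = odd #|X| && odd s.
Proof.
move=> reg; rewrite -[edge_cut X]setTI -odd_sum_degree_in.
by under eq_bigr do rewrite [degree_in _ _]reg; rewrite sum_nat_const oddM.
Qed.

(** The whole vertex set has an empty cut, which is impossible for a set of odd size. *)
Lemma s_graph_even_order (G : multigraph) s :
  0 < s -> s_graph s G -> ~~ odd #|vertex G|.
Proof.
move=> s0 [_ _ cut]; apply/negP; rewrite -cardsT => /cut.
have -> : edge_cut [set: vertex G] = set0.
  by apply/setP => e; rewrite !inE setCT setI0 eqxx andbF.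
by rewrite cards0 leqNgt s0.
Qed.

(** A cut of size one is odd, so by parity [X] is odd, and its cut then has at least [s > 1]
    edges. *)
Lemma s_graph_bridgeless (G : multigraph) s (X : {set vertex G}) :
  1 < s -> s_graph s G -> #|edge_cut X| != 1.
Proof.
move=> s1 [_ reg cut]; apply/eqP => c1.
have := odd_edge_cut X reg; rewrite c1 => /esym/andP[/cut]; rewrite c1; lia.
Qed.

(** In terms of cuts, connectedness of a 2-sum can be checked on the traces of a vertex set on the
    two sides. *)
Lemma connected_edge_cutP (G : multigraph) :
  connected G <-> 0 < #|vertex G| /\
    forall X : {set vertex G}, edge_cut X = set0 -> X = set0 \/ X = setT.
Proof.
split=> -[V0 con]; split=> //.
  move=> X X0; have [->|/set0Pn[x xX]] := eqVneq X set0; [by left|right].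
  apply/setP => y; rewrite inE; have /connectP[p] := con x y.
  elim: p x xX => [x xX _ -> //|z p IH x xX /= /andP[/existsP[e /andP[_ /eqP E]] pz] Y].
  apply: IH pz Y; have := mem_edge_cut X E.
  by rewrite X0 inE xX => /esym/negbT; rewrite negbK.
(* The component of [x] has an empty cut and contains [x], so it is everything. *)
move=> x y; pose X := [set z | connect (adj_in [set: edge G]) x z].
have [|X0|XT] := con X; last by have := in_setT y; rewrite -XT inE.
  apply/setP => e; have [a [b [_ E]]] := ends_pair e.
  have ab : adj_in [set: edge G] a b by apply/existsP; exists e; rewrite inE E eqxx.
  have ba : adj_in [set: edge G] b a.
    by apply/existsP; exists e; rewrite inE E setUC eqxx.
  rewrite (mem_edge_cut _ E) in_set0 !inE.
  suff -> : connect (adj_in [set: edge G]) x a = connect (adj_in [set: edge G]) x b.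
    by rewrite addbb.
  by apply/idP/idP => /connect_trans; apply; apply: connect1.
by have := in_set0 x; rewrite -X0 inE connect0.
Qed.

(** * Cycles: transport along embeddings, and disjointness inside a 2-factor *)

Section Embedding.
Variables (G K : multigraph) (i : vertex G -> vertex K) (j : edge G -> edge K).
Hypotheses (i_inj : injective i) (j_inj : injective j).
Variable C : {set edge G}.
Hypothesis ends_j : {in C, forall e, ends (j e) = i @: ends e}.

Lemma degree_in_imset v : degree_in (j @: C) (i v) = degree_in C v.
Proof.
rewrite /degree_in -(card_imset _ j_inj); congr #|pred_of_set _|.
apply/setP => e; rewrite !inE; apply/andP/imsetP => [[/imsetP[f fC ->]]|[f]].
  by rewrite ends_j // mem_imset // => vf; exists f; rewrite // inE fC.
by rewrite inE => /andP[fC vf] ->; rewrite imset_f // ends_j // mem_imset.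
Qed.

Lemma covered_imset : covered (j @: C) = i @: covered C.
Proof.
apply/setP => v; apply/bigcupP/imsetP => [[_ /imsetP[e eC ->]]|[w]].
  rewrite ends_j // => /imsetP[w we ->]; exists w => //.
  by apply/bigcupP; exists e.
case/bigcupP => e eC we ->; exists (j e); first exact: imset_f.
by rewrite ends_j // imset_f.
Qed.

Lemma adj_in_imset x y : adj_in (j @: C) (i x) (i y) = adj_in C x y.
Proof.
have pairE : i @: [set x; y] = [set i x; i y] by rewrite imsetU1 imset_set1.
apply/existsP/existsP => -[e /andP[eC /eqP E]].
  case/imsetP: eC E => f fC -> E; exists f; rewrite fC /=.
  by apply/eqP/(imset_inj i_inj); rewrite -ends_j // E pairE.
by exists (j e); rewrite imset_f //= ends_j // E pairE.
Qed.

Lemma connect_adj_in_imset x y :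
  connect (adj_in (j @: C)) (i x) (i y) = connect (adj_in C) x y.
Proof.
apply/connectP/connectP => -[p].
  elim: p x => [x _ /i_inj ->|z p IH x /= /andP[xz pz] Y]; first by exists [::].
  (* Edges of [j @: C] have both ends in the image of [i], so a path starting in the image stays
     there and can be pulled back. *)
  have [w zE] : exists w, z = i w.
    case/existsP: xz => e /andP[/imsetP[f fC ->]]; rewrite ends_j // => /eqP E.
    have : z \in [set i x; z] by rewrite !inE eqxx orbT.
    by rewrite -E => /imsetP[w _ ->]; exists w.
  rewrite {}zE in xz pz Y; rewrite adj_in_imset in xz.
  by have [q wq Yq] := IH w pz Y; exists (w :: q) => //=; rewrite xz.
move=> xp ->; exists (map i p); last by rewrite last_map.
by apply: homo_path xp => a b; rewrite adj_in_imset.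
Qed.

(** The condition on ends is restricted to [C] to cover cycles avoiding the rerouted edge of a
    2-sum. With [i] the identity it also serves edge deletion. *)
Lemma is_cycle_imset : is_cycle (j @: C) = is_cycle C.
Proof.
rewrite /is_cycle covered_imset; congr [&& _, _ & _].
- by rewrite -!cards_eq0 card_imset.
- apply/forall_inP/forall_inP => deg v vC; first by rewrite -degree_in_imset deg ?imset_f.
  by case/imsetP: vC => w wC ->; rewrite degree_in_imset deg.
- apply/forall_inP/forall_inP => con x xC; apply/forall_inP => y yC.
    by rewrite -connect_adj_in_imset; move/forall_inP: (con _ (imset_f i xC)); apply; apply: imset_f.
  case/imsetP: xC => x' xC ->; case/imsetP: yC => y' yC ->.
  by rewrite connect_adj_in_imset; move/forall_inP: (con _ xC); apply.
Qed.

End Embedding.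

(** At a vertex of [C] both [C] and [F] have degree 2, so every edge of [F] there belongs to [C]. A
    walk in [D] starting at the common edge therefore never leaves [C]. *)
Lemma cycle_subset_of_meet (G : multigraph) (F C D : {set edge G}) (e : edge G) :
  two_factor F -> C \subset F -> D \subset F -> is_cycle C -> is_cycle D ->
  e \in C -> e \in D -> D \subset C.
Proof.
move=> /forallP tF sCF sDF /and3P[_ /forall_inP degC _] /and3P[_ _ /forall_inP conD] eC eD.
have closed v f : v \in covered C -> f \in F -> v \in ends f -> f \in C.
  move=> vC fF vf.
  have sub : [set g in C | v \in ends g] \subset [set g in F | v \in ends g].
    by apply/subsetP => g; rewrite !inE => /andP[/(subsetP sCF)-> ->].
  have /eqP eqs : [set g in C | v \in ends g] == [set g in F | v \in ends g].
    have /eqP d2 := degC v vC; have /eqP d2' := tF v.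
    by rewrite eqEcard sub; move: d2 d2'; rewrite /degree_in => -> ->.
  by move/setP/(_ f): eqs; rewrite !inE fF vf andbT.
have covP g v : g \in C -> v \in ends g -> v \in covered C.
  by move=> gC vg; apply/bigcupP; exists g.
have [x [y [_ E]]] := ends_pair e.
have xe : x \in ends e by rewrite E !inE eqxx.
have xD : x \in covered D by apply/bigcupP; exists e.
have covDC z : z \in covered D -> z \in covered C.
  move=> zD; have /forall_inP/(_ z zD)/connectP[p] := conD x xD.
  have := covP _ _ eC xe; move: (x); clear -closed covP sDF.
  elim: p => [a aC _ -> //|b p IH a aC /= /andP[/existsP[g /andP[gD /eqP E]] bp] Z].
  apply: IH bp Z; apply: (covP g); last by rewrite E !inE eqxx orbT.
  by apply: closed aC _ _; rewrite ?(subsetP sDF) // E !inE eqxx.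
apply/subsetP => g gD; have [a [b [_ Eg]]] := ends_pair g.
have ag : a \in ends g by rewrite Eg !inE eqxx.
apply: (closed a) ag; last exact: (subsetP sDF).
by apply: covDC; apply/bigcupP; exists g; rewrite ?Eg ?inE ?eqxx.
Qed.

(** Cycles inside a 2-factor that share an edge coincide, so rerouting [e] destroys at most one odd
    cycle. *)
Lemma card_odd_cycles_through (G : multigraph) (F : {set edge G}) (e : edge G) :
  two_factor F -> #|[set C in odd_cycles F | e \in C]| <= (e \in F).
Proof.
move=> tF; case: (boolP (e \in F)) => eF.
  apply/card_le1_eqP => C D; rewrite !inE.
  move=> /andP[/and3P[sC cC _] eC] /andP[/and3P[sD cD _] eD].
  apply/eqP; rewrite eqEsubset; apply/andP; split.
    exact: (cycle_subset_of_meet tF sC sD cC cD eC eD).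
  exact: (cycle_subset_of_meet tF sD sC cD cC eD eC).
rewrite leqn0 cards_eq0; apply/eqP/setP => C; rewrite !inE; apply/negP.
by move=> /andP[/and3P[/subsetP/(_ e) sC _ _] /sC]; rewrite (negPf eF).
Qed.

(** * Factorizations of an edge-deleted graph, and bounds on the oddness *)

(** With [E] the complement of a 1-factor, this expresses 2-factorizations of the deleted graph
    without changing the edge type. *)
Definition factorization_of (G : multigraph) n (E : {set edge G})
    (P : {set {set edge G}}) : bool :=
  [&& partition P E, #|P| == n & [forall F in P, two_factor F]].

Section DeleteEdges.
Variables (G : multigraph) (F : {set edge G}).
Let D := delete_edges F.
Let emb : edge D -> edge G := val.
Let lift (B : {set edge D}) : {set edge G} := emb @: B.

Let emb_inj : injective emb. Proof. exact: val_inj. Qed.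

Let lift_inj : injective lift. Proof. exact: imset_inj emb_inj. Qed.

Let ends_val (B : {set edge D}) :
  {in B, forall e, ends (emb e) = id @: ends e}.
Proof. by move=> e _; rewrite imset_id. Qed.

Let two_factor_lift B : two_factor (lift B) = two_factor B.
Proof.
by apply: eq_forallb => v; rewrite -(@degree_in_imset D G id emb (@inj_id _) emb_inj B (@ends_val B)).
Qed.

Let lift_preim (B : {set edge G}) : B \subset ~: F ->
  lift (emb @^-1: B) = B.
Proof.
move=> sB; apply/setP => e; apply/imsetP/idP => [[f]|eB]; first by rewrite inE => fB ->.
have eF : e \notin F by have := subsetP sB e eB; rewrite inE.
by exists (Sub e eF : edge D); rewrite ?inE /emb ?SubK.
Qed.

Let card_odd_cycles_lift B : #|odd_cycles (lift B)| = #|odd_cycles B|.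
Proof.
rewrite -(card_imset _ lift_inj); congr #|pred_of_set _|; apply/setP => C.
apply/idP/imsetP => [|[C' + ->]]; last first.
  rewrite !inE => /and3P[sC cC oC]; rewrite imsetS //.
  by rewrite (@is_cycle_imset D G id emb (@inj_id _) emb_inj C' (@ends_val C')) cC card_imset //; apply: emb_inj.
rewrite inE => /and3P[sC cC oC].
have sCF : C \subset ~: F.
  apply: subset_trans sC _; apply/subsetP => _ /imsetP[e _ ->].
  by rewrite inE; apply: (valP e).
have CE := lift_preim sCF; set C' := _ @^-1: C in CE; exists C' => //.
rewrite inE -(@is_cycle_imset D G id emb (@inj_id _) emb_inj C' (@ends_val C')) -(card_imset (mem C') emb_inj).
rewrite -/(lift C') CE cC oC !andbT; apply/subsetP => e; rewrite inE => /(subsetP sC).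
by rewrite mem_imset //; apply: emb_inj.
Qed.

Lemma two_factorization_lift n (P : {set {set edge D}}) :
  factorization_of n (~: F) [set lift B | B in P] = two_factorization n P.
Proof.
have liftT : lift setT = ~: F by rewrite -[RHS](lift_preim (subxx _)); congr lift;
  apply/setP => e; rewrite !inE; symmetry; apply: (valP e).
rewrite /factorization_of -liftT imset_partition; last exact: emb_inj.
rewrite card_imset //; congr [&& _, _ & _].
apply/forall_inP/forall_inP => tf B PB; first by rewrite -two_factor_lift tf ?imset_f.
by case/imsetP: PB => B' PB ->; rewrite two_factor_lift tf.
Qed.

Lemma num_odd_cycles_lift (P : {set {set edge D}}) :
  num_odd_cycles [set lift B | B in P] = num_odd_cycles P.
Proof.
rewrite /num_odd_cycles big_imset /=; last by move=> ? ? _ _; apply: lift_inj.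
by apply: eq_bigr => B _; rewrite card_odd_cycles_lift.
Qed.

Lemma lift_surj n (P : {set {set edge G}}) : factorization_of n (~: F) P ->
  exists Q : {set {set edge D}}, P = [set lift B | B in Q].
Proof.
move=> /and3P[/and3P[/eqP cov _ _] _ _].
exists [set emb @^-1: B | B : {set edge G} in P].
(* Every block lies in [~: F], hence is the lift of its own preimage. *)
rewrite -imset_comp -[LHS]imset_id; apply: eq_in_imset => B PB /=.
by rewrite lift_preim // -cov (bigcup_sup B).
Qed.

End DeleteEdges.

(* A witness for the oddness of an [s]-regular graph [G] lives on [G] itself:
   [F] is the deleted 1-factor (empty for even [s]), and [P] splits [~: F]. *)
Definition oddness_witness (s : nat) (G : multigraph) (F : {set edge G})
    (P : {set {set edge G}}) : bool :=
  (if odd s then one_factor F else F == set0)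
  && factorization_of s./2 (~: F) P.

Section Oddness.
Variables (R : realType) (s : nat) (G : multigraph).

Lemma oddness_le (F : {set edge G}) (P : {set {set edge G}}) :
  oddness_witness s F P ->
  (oddness R s G <= ((num_odd_cycles P)%:R)%:E)%E.
Proof.
rewrite /oddness_witness /oddness; case: ifP => _ /andP[F1 fP]; last first.
  by move: F1 fP => /eqP ->; rewrite setC0 => fP; apply: bigmin_le_cond.
have [Q PE] := lift_surj fP; move: fP; rewrite {}PE two_factorization_lift => fQ.
rewrite num_odd_cycles_lift; apply: le_trans (bigmin_le_cond _ _ F1) _.
exact: bigmin_le_cond.
Qed.

Lemma oddness_ge (x : \bar R) :
  (forall (F : {set edge G}) (P : {set {set edge G}}), oddness_witness s F P ->
    x <= ((num_odd_cycles P)%:R)%:E)%E ->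
  (x <= oddness R s G)%E.
Proof.
rewrite /oddness_witness /oddness; case: ifP => _ lb.
  apply: le_bigmin => [|F F1]; first exact: leey.
  apply: le_bigmin => [|P fP]; first exact: leey.
  by rewrite -num_odd_cycles_lift; apply: (lb F); rewrite F1 two_factorization_lift.
apply: le_bigmin => [|P fP]; first exact: leey.
by apply: (lb set0); rewrite eqxx setC0.
Qed.

End Oddness.

(** * Resistance through partial edge colourings *)

(** A partial colouring as a total function: [F] is the set of uncoloured edges, and the values of
    [c] there are meaningless. *)
Definition proper_off (G : multigraph) (k : nat) (F : {set edge G})
    (c : edge G -> 'I_k) : Prop :=
  forall e f, e \notin F -> f \notin F -> e != f ->
    ends e :&: ends f != set0 -> c e != c f.

Lemma edge_colorable_deleteP (G : multigraph) k (F : {set edge G}) : 0 < k ->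
  edge_colorable (delete_edges F) k <-> exists c : edge G -> 'I_k, proper_off F c.
Proof.
move=> k0; split=> [/existsP[c /forallP cP]|[c cP]].
  (* Deleted edges get a dummy colour, available since [k] is positive. *)
  exists (fun e => oapp c (Ordinal k0) (insub e)) => e f eF fF ef meet.
  rewrite !insubT /=; have /forallP/(_ (Sub f fF)) := cP (Sub e eF).
  by rewrite meet !andbT => /implyP; apply.
apply/existsP; exists [ffun e => c (val e)]; apply/forallP => e; apply/forallP => f.
by apply/implyP => /andP[ef meet]; rewrite !ffunE; apply: cP; rewrite ?(valP e) ?(valP f).
Qed.

Lemma max_degree_regular (G : multigraph) s :
  0 < #|vertex G| -> regular G s -> max_degree G = s.
Proof.
move=> /card_gt0P[v _] reg; rewrite /max_degree; under eq_bigr do rewrite reg.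
apply/eqP; rewrite eqn_leq; apply/andP; split; last exact: (leq_bigmax v).
by apply/bigmax_leqP.
Qed.

Section Resistance.
Variables (s : nat) (G : multigraph).
Hypotheses (s0 : 0 < s) (sG : s_graph s G).

Let maxdeg : max_degree G = s.
Proof. by case: sG => -[V0 _] reg _; apply: max_degree_regular. Qed.

Let colorableT : edge_colorable (delete_edges [set: edge G]) (max_degree G).
Proof.
rewrite maxdeg; apply/(edge_colorable_deleteP _ s0).
by exists (fun=> Ordinal s0) => e f; rewrite inE.
Qed.

Lemma resistance_le (F : {set edge G}) (c : edge G -> 'I_s) :
  proper_off F c -> resistance G <= #|F|.
Proof.
move=> cP; rewrite /resistance; case: arg_minnP => // A _; apply.
by rewrite maxdeg; apply/edge_colorable_deleteP => //; exists c.
Qed.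

Lemma resistance_witness : exists (F : {set edge G}) (c : edge G -> 'I_s),
  #|F| = resistance G /\ proper_off F c.
Proof.
rewrite /resistance; case: arg_minnP => // A.
by rewrite maxdeg => /(edge_colorable_deleteP _ s0)[c cP] _; exists A, c.
Qed.

End Resistance.

Definition missing (G : multigraph) (k : nat) (F : {set edge G})
    (c : edge G -> 'I_k) (v : vertex G) (a : 'I_k) : Prop :=
  forall e, e \notin F -> v \in ends e -> c e != a.

(** As [e] is uncoloured, at most [s - 1] coloured edges meet [v], too few to use all [s]
    colours. *)
Lemma exists_missing (G : multigraph) s (F : {set edge G}) (c : edge G -> 'I_s)
    (e : edge G) (v : vertex G) :
  regular G s -> e \in F -> v \in ends e -> exists a, missing F c v a.
Proof.
move=> reg eF ve; pose A := c @: [set f in ~: F | v \in ends f].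
suff /subsetPn[a _ aA] : ~~ ([set: 'I_s] \subset A).
  by exists a => f fF vf; apply: contraNneq aA => <-; rewrite imset_f // !inE fF.
apply/negP => /subset_leq_card; rewrite cardsT card_ord leqNgt => /negP; apply.
apply: leq_ltn_trans (leq_imset_card _ _) _; rewrite -[ltnRHS](reg v).
apply: proper_card; apply/properP; split; last by exists e; rewrite !inE ?eF ?ve.
by apply/subsetP => f; rewrite !inE => /andP[].
Qed.

(* If both ends of an uncoloured edge missed the same colour, that edge could be
   coloured too. *)
Lemma resistance_edge (G : multigraph) s : 0 < s -> s_graph s G ->
  0 < resistance G ->
  exists (F : {set edge G}) (c : edge G -> 'I_s) e x y a b,
    [/\ #|F| = resistance G /\ proper_off F c, e \in F /\ ends e = [set x; y],
        missing F c x a, missing F c y b & a != b].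
Proof.
move=> s0 sG; have [F [c [FE cP]]] := resistance_witness s0 sG.
rewrite -FE => /card_gt0P[e eF]; have [x [y [_ E]]] := ends_pair e.
have reg : regular G s by case: sG.
have [a xa] : exists a, missing F c x a.
  by apply: (exists_missing _ reg eF); rewrite E !inE eqxx.
have [b yb] : exists a, missing F c y a.
  by apply: (exists_missing _ reg eF); rewrite E !inE eqxx orbT.
exists F, c, e, x, y, a, b; split=> //; apply/eqP => ab.
have miss f : f \notin F -> ends e :&: ends f != set0 -> c f != a.
  move=> fF /set0Pn[z]; rewrite inE E !inE => /andP[/orP[]/eqP-> zf]; first exact: xa.
  by rewrite ab; apply: yb.
have := resistance_le s0 sG (F := F :\ e) (c := fun f => if f == e then a else c f).
rewrite -FE (cardsD1 e F) eF ltnn => /(_ _)/wrap[] // f g.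
rewrite !inE; have [->|fe] /= := eqVneq f e; have [->|ge] //= := eqVneq g e.
- by move=> _ gF _ meet; rewrite eq_sym; apply: miss.
- by move=> fF _ _; rewrite setIC; apply: miss.
- exact: cP.
Qed.

(** * The 2-sum: degrees, cuts and odd cycles *)

Lemma sum_mem_partition_le1 (T : finType) (P : {set {set T}}) (E : {set T}) (x : T) :
  partition P E -> \sum_(B in P) (x \in B) <= 1.
Proof.
move=> /and3P[_ /trivIsetP tI _].
have -> : \sum_(B in P) (x \in B) = #|[set B in P | x \in B]|.
  by rewrite -sum1dep_card big_mkcondr; apply: eq_bigr => B _; case: (x \in B).
apply/card_le1_eqP => A B; rewrite !inE => /andP[PA xA] /andP[PB xB].
have [//|/eqP neq] := eqVneq B A.
by have /disjointFr/(_ xB) := tI _ _ PB PA (introN eqP neq); rewrite xA.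
Qed.

(* Both new edges of the 2-sum reuse the names of the removed ones: [inl e1] now
   joins [u1] to [u2], and [inr e2] joins [v1] to [v2]. *)
Section TwoSum.
Variables (G H : multigraph) (e1 : edge G) (e2 : edge H).
Variables (u1 v1 : vertex G) (u2 v2 : vertex H).

Definition two_sum_ends (e : edge G + edge H) : {set vertex G + vertex H} :=
  match e with
  | inl e => if e == e1 then [set inl u1; inr u2] else inl @: ends e
  | inr e => if e == e2 then [set inl v1; inr v2] else inr @: ends e
  end.

Lemma card_two_sum_ends e : #|two_sum_ends e| = 2.
Proof.
by case: e => e /=; case: ifP => _; rewrite ?cards2 // card_imset ?card_ends // => ? ? [].
Qed.

Definition two_sum : multigraph := Multigraph card_two_sum_ends.

Definition vertexl : vertex G -> vertex two_sum := inl.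
Definition vertexr : vertex H -> vertex two_sum := inr.
Definition edgel : edge G -> edge two_sum := inl.
Definition edger : edge H -> edge two_sum := inr.

Local Notation il := vertexl.
Local Notation ir := vertexr.
Local Notation jl := edgel.
Local Notation jr := edger.

Hypotheses (E1 : ends e1 = [set u1; v1]) (E2 : ends e2 = [set u2; v2]).

Lemma vertexl_inj : injective il. Proof. by move=> ? ? []. Qed.
Lemma vertexr_inj : injective ir. Proof. by move=> ? ? []. Qed.
Lemma edgel_inj : injective jl. Proof. by move=> ? ? []. Qed.
Lemma edger_inj : injective jr. Proof. by move=> ? ? []. Qed.

Lemma ends_edgel e : e != e1 -> ends (jl e) = il @: ends e.
Proof. by move=> /negPf ne; rewrite /ends /= ne. Qed.

Lemma ends_edger e : e != e2 -> ends (jr e) = ir @: ends e.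
Proof. by move=> /negPf ne; rewrite /ends /= ne. Qed.

Lemma ends_edgel1 : ends (jl e1) = [set il u1; ir u2].
Proof. by rewrite /ends /= eqxx. Qed.

Lemma ends_edger2 : ends (jr e2) = [set il v1; ir v2].
Proof. by rewrite /ends /= eqxx. Qed.

Let u1v1 : u1 != v1.
Proof. by have := card_ends e1; rewrite E1 cards2; case: eqP. Qed.

Let u2v2 : u2 != v2.
Proof. by have := card_ends e2; rewrite E2 cards2; case: eqP. Qed.

Lemma card_edge_two_sum (A : {set edge two_sum}) :
  #|A| = #|jl @^-1: A| + #|jr @^-1: A|.
Proof. exact: card_sum_set. Qed.

(** The removed edge [e1] is replaced by [jl e1] at [u1] but by [jr e2] at [v1]. The degrees agree
    at both vertices because [B] contains both new edges or neither. *)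
Lemma degree_in_vertexl (B : {set edge two_sum}) x : (jl e1 \in B) = (jr e2 \in B) ->
  degree_in B (il x) = degree_in (jl @^-1: B) x.
Proof.
move=> cl; rewrite /degree_in card_edge_two_sum.
rewrite (cardsD1 e1 (jl @^-1: _)) (cardsD1 e2 (jr @^-1: _)) (cardsD1 e1 [set _ in jl @^-1: _ | _]).
rewrite !inE -cl ends_edgel1 ends_edger2 E1 !inE.
have -> : #|jr @^-1: [set e in B | il x \in ends e] :\ e2| = 0.
  apply/eqP; rewrite cards_eq0; apply/eqP/setP => e; rewrite !inE.
  by apply/negP => /and3P[ne _]; rewrite ends_edger // inl_notin_imset_inr.
have -> : jl @^-1: [set e in B | il x \in ends e] :\ e1 =
          [set e in jl @^-1: B | x \in ends e] :\ e1.
  apply/setP => e; rewrite !inE.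
  by apply: andb_id2l => ne; rewrite ends_edgel // mem_imset //; apply: vertexl_inj.
rewrite !(inj_eq vertexl_inj) -!/(ir _) [_ == ir _]/= !orbF.
case: (jl e1 \in B) => /=; last by rewrite !add0n !addn0.
by case: eqP => [->|_]; rewrite ?(negPf u1v1) /=; lia.
Qed.

Lemma degree_in_vertexr (B : {set edge two_sum}) x : (jl e1 \in B) = (jr e2 \in B) ->
  degree_in B (ir x) = degree_in (jr @^-1: B) x.
Proof.
move=> cl; rewrite /degree_in card_edge_two_sum.
rewrite (cardsD1 e1 (jl @^-1: _)) (cardsD1 e2 (jr @^-1: _)) (cardsD1 e2 [set _ in jr @^-1: _ | _]).
rewrite !inE cl ends_edgel1 ends_edger2 E2 !inE.
have -> : #|jl @^-1: [set e in B | ir x \in ends e] :\ e1| = 0.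
  apply/eqP; rewrite cards_eq0; apply/eqP/setP => e; rewrite !inE.
  by apply/negP => /and3P[ne _]; rewrite ends_edgel // inr_notin_imset_inl.
have -> : jr @^-1: [set e in B | ir x \in ends e] :\ e2 =
          [set e in jr @^-1: B | x \in ends e] :\ e2.
  apply/setP => e; rewrite !inE.
  by apply: andb_id2l => ne; rewrite ends_edger // mem_imset //; apply: vertexr_inj.
rewrite !(inj_eq vertexr_inj) -!/(il _) [_ == il _]/= !orFb.
case: (jr e2 \in B) => /=; last by rewrite !add0n.
by case: eqP => [->|_]; rewrite ?(negPf u2v2) /=; lia.
Qed.

Lemma edgel1_cut (X : {set vertex two_sum}) :
  (jl e1 \in edge_cut X) = (u1 \in il @^-1: X) (+) (u2 \in ir @^-1: X).
Proof. by rewrite (mem_edge_cut X ends_edgel1) !inE. Qed.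

Lemma edger2_cut (X : {set vertex two_sum}) :
  (jr e2 \in edge_cut X) = (v1 \in il @^-1: X) (+) (v2 \in ir @^-1: X).
Proof. by rewrite (mem_edge_cut X ends_edger2) !inE. Qed.

Lemma edgel_cut (X : {set vertex two_sum}) e : e != e1 ->
  (jl e \in edge_cut X) = (e \in edge_cut (il @^-1: X)).
Proof.
have [x [y [_ E]]] := ends_pair e => ne; rewrite (mem_edge_cut _ E).
by rewrite (@mem_edge_cut _ _ (il x) (il y)) ?inE // ends_edgel // E imsetU1 imset_set1.
Qed.

Lemma edger_cut (X : {set vertex two_sum}) e : e != e2 ->
  (jr e \in edge_cut X) = (e \in edge_cut (ir @^-1: X)).
Proof.
have [x [y [_ E]]] := ends_pair e => ne; rewrite (mem_edge_cut _ E).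
by rewrite (@mem_edge_cut _ _ (ir x) (ir y)) ?inE // ends_edger // E imsetU1 imset_set1.
Qed.

Lemma card_edge_cut_two_sum (X : {set vertex two_sum}) :
  #|edge_cut X| = (jl e1 \in edge_cut X) + #|edge_cut (il @^-1: X) :\ e1| +
                  ((jr e2 \in edge_cut X) + #|edge_cut (ir @^-1: X) :\ e2|).
Proof.
rewrite card_edge_two_sum (cardsD1 e1 (jl @^-1: _)) (cardsD1 e2 (jr @^-1: _)).
congr (_ + _ + (_ + _)); rewrite ?inE //; congr #|pred_of_set _|; apply/setP => e.
  by rewrite 2!in_setD1; case: (boolP (e == e1)) => //= ne; rewrite in_set edgel_cut.
by rewrite 2!in_setD1; case: (boolP (e == e2)) => //= ne; rewrite in_set edger_cut.
Qed.

(** The vertices of [G] have a cut consisting of the two new edges. Their degree sum in [B] is even,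
    so [B] contains an even number of these edges. *)
Lemma two_sum_cut_closed (B : {set edge two_sum}) d :
  ~~ odd (#|vertex G| * d) -> (forall v, degree_in B v = d) ->
  (jl e1 \in B) = (jr e2 \in B).
Proof.
move=> ev deg; pose X := il @: [set: vertex G].
have := odd_sum_degree_in B X; under eq_bigr do rewrite deg.
rewrite sum_nat_const card_imset ?cardsT; last exact: vertexl_inj.
rewrite (negPf ev).
have -> : edge_cut X = [set jl e1; jr e2].
  have XL : il @^-1: X = setT.
    by apply/setP => x; rewrite !inE mem_imset ?inE //; apply: vertexl_inj.
  have XR : ir @^-1: X = set0 by apply/setP => x; rewrite !inE inr_notin_imset_inl.
  apply/setP => -[e|e]; rewrite !inE.
    rewrite -/(jl e) orbF (inj_eq edgel_inj); have [->|ne] := eqVneq e e1.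
      by have := edgel1_cut X; rewrite XL XR !inE.
    by have := edgel_cut X ne; rewrite XL !inE => ->; rewrite setCT setI0 eqxx andbF.
  rewrite -/(jr e) (inj_eq edger_inj); have [->|ne] := eqVneq e e2.
    by have := edger2_cut X; rewrite XL XR !inE.
  by have := edger_cut X ne; rewrite XR !inE => ->; rewrite setI0 eqxx.
rewrite (cardsD1 (jl e1)) (cardsD1 (jr e2)) !inE !eqxx orbT !andbT.
rewrite [X in _ + (_ + X)](_ : _ = 0); last first.
  apply/eqP; rewrite cards_eq0; apply/eqP/setP => e; rewrite !inE.
  by case: eqP => //= _; case: eqP => //= _; rewrite andbF.
by rewrite [jr e2 == jl e1]/=; do 2!case: (_ \in B).
Qed.

(** Odd cycles avoiding [e1] or [e2] survive unchanged in [B], and those from different sides are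
    distinct because cycles are nonempty. On each side at most one odd cycle uses the removed
    edge. *)
Lemma card_odd_cycles_two_sum (B : {set edge two_sum}) :
  two_factor (jl @^-1: B) -> two_factor (jr @^-1: B) ->
  #|odd_cycles (jl @^-1: B)| + #|odd_cycles (jr @^-1: B)| <=
  #|odd_cycles B| + ((jl e1 \in B) + (jr e2 \in B)).
Proof.
move=> tl tr.
have := card_odd_cycles_through e1 tl; have := card_odd_cycles_through e2 tr.
rewrite !inE => through2 through1.
pose Cl := [set C in odd_cycles (jl @^-1: B) | e1 \notin C].
pose Cr := [set C in odd_cycles (jr @^-1: B) | e2 \notin C].
have splitl : #|odd_cycles (jl @^-1: B)| =
    #|[set C in odd_cycles (jl @^-1: B) | e1 \in C]| + #|Cl|.
  rewrite -(cardsID [set C : {set edge G} | e1 \in C]).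
  by congr (_ + _); congr #|pred_of_set _|; apply/setP => C; rewrite !inE // andbC.
have splitr : #|odd_cycles (jr @^-1: B)| =
    #|[set C in odd_cycles (jr @^-1: B) | e2 \in C]| + #|Cr|.
  rewrite -(cardsID [set C : {set edge H} | e2 \in C]).
  by congr (_ + _); congr #|pred_of_set _|; apply/setP => C; rewrite !inE // andbC.
suff : #|Cl| + #|Cr| <= #|odd_cycles B| by lia.
pose Il := [set jl @: C | C : {set edge G} in Cl].
pose Ir := [set jr @: C | C : {set edge H} in Cr].
have <- : #|Il| = #|Cl| by rewrite card_imset //; apply: imset_inj edgel_inj.
have <- : #|Ir| = #|Cr| by rewrite card_imset //; apply: imset_inj edger_inj.
have disj : #|Il :&: Ir| = 0.
  apply/eqP; rewrite cards_eq0; apply/eqP/setP => D; rewrite !inE; apply/negP.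
  move=> /andP[/imsetP[C ClC ->]] /imsetP[C' _].
  move: ClC; rewrite !inE => /andP[/and3P[_ /andP[/set0Pn[e eC] _] _] _] /setP/(_ (jl e)).
  by rewrite imset_f // inl_notin_imset_inr.
have := cardsUI Il Ir; rewrite disj addn0 => <-.
apply/subset_leq_card/subsetP => D; rewrite in_setU => /orP[]/imsetP[C + ->].
  rewrite !inE => /andP[/and3P[sC cC oC] eC].
  rewrite (@is_cycle_imset _ _ il jl vertexl_inj edgel_inj).
    rewrite cC card_imset ?oC ?andbT; last exact: edgel_inj.
    by apply/subsetP => _ /imsetP[e /(subsetP sC) + ->]; rewrite inE.
  by move=> e eC'; apply: ends_edgel; apply: contraNneq eC => <-.
rewrite !inE => /andP[/and3P[sC cC oC] eC].
rewrite (@is_cycle_imset _ _ ir jr vertexr_inj edger_inj).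
  rewrite cC card_imset ?oC ?andbT; last exact: edger_inj.
  by apply/subsetP => _ /imsetP[e /(subsetP sC) + ->]; rewrite inE.
by move=> e eC'; apply: ends_edger; apply: contraNneq eC => <-.
Qed.

(** * Closure of [s]-graphs under 2-sums, with the oddness and resistance bounds *)

Section Structure.
Variable s : nat.
Hypotheses (s3 : 2 < s) (sG : s_graph s G) (sH : s_graph s H).

Let s0 : 0 < s. Proof. by lia. Qed.
Let s1 : 1 < s. Proof. by lia. Qed.

Lemma regular_two_sum : regular two_sum s.
Proof.
case: sG sH => _ regG _ [_ regH _] [x|x]; rewrite /degree.
  by rewrite [LHS]degree_in_vertexl ?inE // preimsetT; apply: regG.
by rewrite [LHS]degree_in_vertexr ?inE // preimsetT; apply: regH.
Qed.

(** If [X] has an empty cut, its traces can cut only [e1] and [e2], hence nothing by bridgelessness.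
    Each trace is then empty or full, and the uncut edge from [u1] to [u2] forces the same choice on
    both sides. *)
Lemma connected_two_sum : connected two_sum.
Proof.
case: (sG) (sH) => cG _ _ [cH _ _].
have /connected_edge_cutP[VG conG] := cG.
have /connected_edge_cutP[_ conH] := cH.
apply/connected_edge_cutP; split; first by rewrite card_sum addn_gt0 VG.
move=> X X0; have := card_edge_cut_two_sum X.
rewrite {1}X0 cards0; move: (edgel1_cut X); set Xl := il @^-1: X; set Xr := ir @^-1: X.
rewrite X0 in_set0 => ul sum0.
have cutl : edge_cut Xl = set0.
  have := s_graph_bridgeless Xl s1 sG; apply: contraNeq; rewrite -card_gt0.
  by have := cardsD1 e1 (edge_cut Xl); lia.
have cutr : edge_cut Xr = set0.
  have := s_graph_bridgeless Xr s1 sH; apply: contraNeq; rewrite -card_gt0.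
  by have := cardsD1 e2 (edge_cut Xr); lia.
have XE : X = il @: Xl :|: ir @: Xr.
  apply/setP => -[x|x]; rewrite in_setU.
    by rewrite mem_imset_inl inl_notin_imset_inr orbF inE.
  by rewrite mem_imset_inr inr_notin_imset_inl inE.
case: (conG _ cutl) (conH _ cutr) ul XE => -> [] ->; rewrite !inE //= => _.
  by move=> ->; left; rewrite !imset0 setU0.
move=> ->; right; apply/setP => -[x|x]; rewrite !inE.
  by rewrite mem_imset_inl inE.
by rewrite mem_imset_inr inE orbT.
Qed.

(* Say the odd part of [X] lies in [G]. Replacing [e1] by [u1 u2] loses an edge of
   its cut only if [X] also separates [u2] from [v2], and then bridgelessness of [H]
   supplies another edge. *)
Lemma odd_cut_two_sum (X : {set vertex two_sum}) : odd #|X| -> s <= #|edge_cut X|.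
Proof.
case: (sG) (sH) => _ _ cutG [_ _ cutH].
rewrite card_sum_set -/(il @^-1: X) -/(ir @^-1: X) card_edge_cut_two_sum edgel1_cut edger2_cut.
set Xl := il @^-1: X; set Xr := ir @^-1: X => oX.
have := cardsD1 e1 (edge_cut Xl); have := cardsD1 e2 (edge_cut Xr).
have := s_graph_bridgeless Xl s1 sG; have := s_graph_bridgeless Xr s1 sH.
rewrite (mem_edge_cut Xl E1) (mem_edge_cut Xr E2).
have := @cutG Xl; have := @cutH Xr.
move: oX; rewrite oddD; case: (odd #|Xl|); case: (odd #|Xr|) => // _.
  move=> _ /(_ isT).
  by case: (u1 \in Xl); case: (v1 \in Xl); case: (u2 \in Xr); case: (v2 \in Xr) => /=; lia.
move=> /(_ isT) + _.
by case: (u1 \in Xl); case: (v1 \in Xl); case: (u2 \in Xr); case: (v2 \in Xr) => /=; lia.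
Qed.

Lemma s_graph_two_sum : s_graph s two_sum.
Proof. split; [exact: connected_two_sum|exact: regular_two_sum|exact: odd_cut_two_sum]. Qed.

(** The witnesses for [G] and [H] are the preimages of [F] and of the blocks of [P] under the two
    edge maps. *)
Lemma two_sum_witness (F : {set edge two_sum}) (P : {set {set edge two_sum}}) :
  oddness_witness s F P ->
  exists F1 P1 F2 P2,
    [/\ @oddness_witness s G F1 P1, @oddness_witness s H F2 P2
      & num_odd_cycles P1 + num_odd_cycles P2 <= num_odd_cycles P + 2].
Proof.
move=> /andP[F1 /and3P[part /eqP cardP /forall_inP tfP]].
have evG := s_graph_even_order s0 sG.
have clB B : B \in P -> (jl e1 \in B) = (jr e2 \in B).
  move=> /tfP/forallP tB; apply: (@two_sum_cut_closed _ 2) => [|v]; last exact/eqP.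
  by rewrite oddM andbF.
(* For a 1-factor the degree sum over [G] is the order of [G], so evenness of that order enters
   here. *)
have clF : odd s -> one_factor F -> (jl e1 \in F) = (jr e2 \in F).
  move=> _ /forallP tF; apply: (@two_sum_cut_closed _ 1) => [|v]; last exact/eqP.
  by rewrite muln1.
have tl B : B \in P -> two_factor (jl @^-1: B).
  move=> PB; apply/forallP => v; rewrite -degree_in_vertexl ?clB //.
  by have /forallP := tfP _ PB.
have tr B : B \in P -> two_factor (jr @^-1: B).
  move=> PB; apply/forallP => v; rewrite -degree_in_vertexr ?clB //.
  by have /forallP := tfP _ PB.
have nz (K : multigraph) (B : {set edge K}) : 0 < #|vertex K| -> two_factor B -> B != set0.
  move=> /card_gt0P[v _] /forallP/(_ v) tB; apply: contraTneq tB => ->.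
  rewrite /degree_in (_ : [set _ in _ | _] = set0) ?cards0 //.
  by apply/setP => e; rewrite !inE.
have VG : 0 < #|vertex G| by case: sG => -[].
have VH : 0 < #|vertex H| by case: sH => -[].
have [partl injl] := preimset_partition part (fun B PB => nz _ _ VG (tl B PB)).
have [partr injr] := preimset_partition part (fun B PB => nz _ _ VH (tr B PB)).
exists (jl @^-1: F), [set jl @^-1: B | B : {set edge two_sum} in P].
exists (jr @^-1: F), [set jr @^-1: B | B : {set edge two_sum} in P].
split.
- apply/andP; split.
    move: F1 clF; case: ifP => [_ oF /(_ isT oF) cl|_ /eqP -> _]; last by rewrite preimset0.
    by apply/forallP => v; rewrite -degree_in_vertexl //; move/forallP: oF.
  rewrite /factorization_of -preimsetC partl card_in_imset // cardP eqxx /=.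
  by apply/forall_inP => _ /imsetP[B PB ->]; apply: tl.
- apply/andP; split.
    move: F1 clF; case: ifP => [_ oF /(_ isT oF) cl|_ /eqP -> _]; last by rewrite preimset0.
    by apply/forallP => v; rewrite -degree_in_vertexr //; move/forallP: oF.
  rewrite /factorization_of -preimsetC partr card_in_imset // cardP eqxx /=.
  by apply/forall_inP => _ /imsetP[B PB ->]; apply: tr.
rewrite /num_odd_cycles !big_imset //= -big_split /=.
(* Each new edge lies in at most one 2-factor, so over all of [P] at most two odd cycles are
   lost. *)
have le1 := sum_mem_partition_le1 (jl e1) part.
have le2 := sum_mem_partition_le1 (jr e2) part.
apply: leq_trans (leq_add (leqnn _) (leq_add le1 le2)); rewrite -!big_split /=.
by apply: leq_sum => B PB; apply: card_odd_cycles_two_sum; [apply: tl|apply: tr].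
Qed.

Lemma oddness_two_sum (R : realType) :
  (oddness R s G + oddness R s H - 2%:E <= oddness R s two_sum)%E.
Proof.
apply: oddness_ge => F P /two_sum_witness[F1 [P1 [F2 [P2 [w1 w2 le]]]]].
rewrite leeBlDr //; apply: le_trans (leeD (oddness_le R w1) (oddness_le R w2)) _.
by rewrite -!EFinD lee_fin -!natrD ler_nat.
Qed.

(** Colour [a] is missing at both ends of the edge from [u1] to [u2], and [b] at both ends of the
    edge from [v1] to [v2], so both new edges can be coloured. *)
Lemma resistance_two_sum (F1 : {set edge G}) (c1 : edge G -> 'I_s)
    (F2 : {set edge H}) (c2 : edge H -> 'I_s) (a b : 'I_s) :
  e1 \in F1 -> e2 \in F2 -> proper_off F1 c1 -> proper_off F2 c2 ->
  missing F1 c1 u1 a -> missing F1 c1 v1 b ->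
  missing F2 c2 u2 a -> missing F2 c2 v2 b -> a != b ->
  resistance two_sum + 2 <= #|F1| + #|F2|.
Proof.
move=> eF1 eF2 p1 p2 m1a m1b m2a m2b ab.
(* The names [e1] and [e2] leave the uncoloured sets; this is the gain of 2. *)
pose F : {set edge two_sum} := jl @: (F1 :\ e1) :|: jr @: (F2 :\ e2).
pose c (e : edge two_sum) : 'I_s := match e with
  | inl e => if e == e1 then a else c1 e
  | inr e => if e == e2 then b else c2 e end.
have FE : #|F| <= #|F1 :\ e1| + #|F2 :\ e2|.
  apply: leq_trans (leq_card_setU _ _) _.
  by rewrite !card_imset //; [apply: edger_inj|apply: edgel_inj].
suff cP : proper_off F c.
  have := resistance_le s0 s_graph_two_sum cP.
  by have := cardsD1 e1 F1; have := cardsD1 e2 F2; rewrite eF1 eF2; lia.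
have Fl e : (inl e \notin F) = (e == e1) || (e \notin F1).
  by rewrite in_setU mem_imset_inl inl_notin_imset_inr orbF !inE negb_and negbK.
have Fr e : (inr e \notin F) = (e == e2) || (e \notin F2).
  by rewrite in_setU mem_imset_inr inr_notin_imset_inl !inE negb_and negbK.
have meetl e z : e != e1 -> z \in ends (jl e) -> exists2 x, z = il x & x \in ends e.
  by move=> ne; rewrite ends_edgel // => /imsetP[x xe ->]; exists x.
have meetr e z : e != e2 -> z \in ends (jr e) -> exists2 x, z = ir x & x \in ends e.
  by move=> ne; rewrite ends_edger // => /imsetP[x xe ->]; exists x.
(* The next four facts: an old coloured edge that meets a new edge avoids the colour of that new
   edge. *)
have c1a e z : e != e1 -> e \notin F1 -> z \in ends (jl e1) -> z \in ends (jl e) -> c1 e != a.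
  move=> ne eF; rewrite ends_edgel1 !inE => zE /(meetl _ _ ne)[x zx xe].
  by apply: m1a => //; move: zE; rewrite zx => /orP[/eqP[<-]|].
have c1b e z : e != e1 -> e \notin F1 -> z \in ends (jr e2) -> z \in ends (jl e) -> c1 e != b.
  move=> ne eF; rewrite ends_edger2 !inE => zE /(meetl _ _ ne)[x zx xe].
  by apply: m1b => //; move: zE; rewrite zx => /orP[/eqP[<-]|].
have c2a e z : e != e2 -> e \notin F2 -> z \in ends (jl e1) -> z \in ends (jr e) -> c2 e != a.
  move=> ne eF; rewrite ends_edgel1 !inE => zE /(meetr _ _ ne)[x zx xe].
  by apply: m2a => //; move: zE; rewrite zx => /orP[|/eqP[<-]].
have c2b e z : e != e2 -> e \notin F2 -> z \in ends (jr e2) -> z \in ends (jr e) -> c2 e != b.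
  move=> ne eF; rewrite ends_edger2 !inE => zE /(meetr _ _ ne)[x zx xe].
  by apply: m2b => //; move: zE; rewrite zx => /orP[|/eqP[<-]].
have cl e : c (jl e) = if e == e1 then a else c1 e by [].
have cr e : c (jr e) = if e == e2 then b else c2 e by [].
move=> [e|e] [f|f]; rewrite ?Fl ?Fr => + + + /set0Pn[z]; rewrite in_setI => + + + /andP[].
- rewrite -/(jl e) -/(jl f) !cl; have [->|ne] := eqVneq e e1; have [->|nf] := eqVneq f e1.
  + by rewrite eqxx.
  + by move=> _ fF _ ze zf; rewrite eq_sym; exact: (c1a f z nf fF ze zf).
  + by move=> eF _ _ ze zf; exact: (c1a e z ne eF zf ze).
  move=> eF fF; rewrite (inj_eq edgel_inj) => ef.
  move=> /(meetl _ _ ne)[x -> xe] /(meetl _ _ nf)[y /vertexl_inj <- yf].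
  by apply: p1 => //; apply/set0Pn; exists x; rewrite inE xe.
- rewrite -/(jl e) -/(jr f) cl cr; have [->|ne] := eqVneq e e1; have [->|nf] := eqVneq f e2.
  + by [].
  + by move=> _ fF _ ze zf; rewrite eq_sym; exact: (c2a f z nf fF ze zf).
  + by move=> eF _ _ ze zf; exact: (c1b e z ne eF zf ze).
  by move=> _ _ _ /(meetl _ _ ne)[x -> _] /(meetr _ _ nf)[].
- rewrite -/(jr e) -/(jl f) cr cl; have [->|ne] := eqVneq e e2; have [->|nf] := eqVneq f e1.
  + by rewrite [b == a]eq_sym.
  + by move=> _ fF _ ze zf; rewrite eq_sym; exact: (c1b f z nf fF ze zf).
  + by move=> eF _ _ ze zf; exact: (c2a e z ne eF zf ze).
  by move=> _ _ _ /(meetr _ _ ne)[x -> _] /(meetl _ _ nf)[].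
- rewrite -/(jr e) -/(jr f) !cr; have [->|ne] := eqVneq e e2; have [->|nf] := eqVneq f e2.
  + by rewrite eqxx.
  + by move=> _ fF _ ze zf; rewrite eq_sym; exact: (c2b f z nf fF ze zf).
  + by move=> eF _ _ ze zf; exact: (c2b e z ne eF zf ze).
  move=> eF fF; rewrite (inj_eq edger_inj) => ef.
  move=> /(meetr _ _ ne)[x -> xe] /(meetr _ _ nf)[y /vertexr_inj <- yf].
  by apply: p2 => //; apply/set0Pn; exists x; rewrite inE xe.
Qed.

End Structure.
End TwoSum.

(** * Iterated gluing and the limit of the ratio *)

(** Aligns the missing colours of [H] with those of [G]. The first transposition takes [a'] to [a];
    the second takes the image of [b'] to [b] and fixes [a]. *)
Lemma perm_two_points (T : finType) (a b a' b' : T) : a != b -> a' != b' ->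
  exists p : {perm T}, p a' = a /\ p b' = b.
Proof.
move=> ab ab'; pose q := tperm a' a.
exists (q * tperm (q b') b)%g; rewrite !permM tpermL; split=> //.
rewrite [q a']tpermL tpermD // 1?eq_sym //.
by rewrite -[X in X != _](tpermL a' a) (inj_eq perm_inj).
Qed.

Lemma exists_two_sum (R : realType) s (G H : multigraph) :
  2 < s -> s_graph s G -> s_graph s H -> 0 < resistance G -> 0 < resistance H ->
  exists K, [/\ s_graph s K, resistance K + 2 <= resistance G + resistance H
    & (oddness R s G + oddness R s H - 2%:E <= oddness R s K)%E].
Proof.
move=> s3 sG sH rG rH; have s0 : 0 < s by lia.
have [F1 [c1 [e1 [u1 [v1 [a [b [[<- p1] [eF1 E1] m1a m1b ab]]]]]]]] := resistance_edge s0 sG rG.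
have [F2 [c2 [e2 [u2 [v2 [a' [b' [[<- p2] [eF2 E2] m2a m2b ab']]]]]]]] := resistance_edge s0 sH rH.
have [p [pa pb]] := perm_two_points ab ab'.
exists (two_sum e1 e2 u1 v1 u2 v2); split.
- exact: s_graph_two_sum.
- apply: (resistance_two_sum E1 E2 s3 sG sH (c2 := fun e => p (c2 e)) eF1 eF2 p1 _ m1a m1b _ _ ab).
  + by move=> e f eF fF ef meet; rewrite (inj_eq perm_inj); apply: p2.
  + by move=> e eF ue; rewrite -pa (inj_eq perm_inj); apply: m2a.
  + by move=> e eF ue; rewrite -pb (inj_eq perm_inj); apply: m2b.
- exact: oddness_two_sum.
Qed.

Local Open Scope ring_scope.

(** The real [x] stands in for the oddness of [H], which may be infinite. The positivity assumption
    supplies an uncoloured edge at which the next copy of [H] is glued. *)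
Lemma iterated_two_sum (R : realType) (s : nat) (H : multigraph) (x : R) :
  (2 < s)%N -> s_graph s H -> (2 < resistance H)%N -> 2 < x ->
  (x%:E <= oddness R s H)%E ->
  (forall G, s_graph s G -> (0 < oddness R s G)%E -> (0 < resistance G)%N) ->
  forall n, exists G, [/\ s_graph s G,
    (resistance G)%:R <= n%:R * ((resistance H)%:R - 2) + (resistance H)%:R :> R
    & ((n%:R * (x - 2) + x)%:E <= oddness R s G)%E].
Proof.
move=> s3 sH rH x2 xH pos; elim=> [|n [G [sG rG xG]]].
  by exists H; split; rewrite // !mul0r add0r.
have xG0 : (0 < oddness R s G)%E.
  apply: lt_le_trans xG; rewrite lte_fin.
  have : 0 <= n%:R * (x - 2) by apply: mulr_ge0 => //; lra.
  by lra.
have [K [sK rK xK]] := exists_two_sum R s3 sG sH (pos G sG xG0) (ltn_trans (isT : 0 < 2)%N rH).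
exists K; split=> //.
  have : (resistance K + 2)%:R <= (resistance G + resistance H)%:R :> R by rewrite ler_nat.
  by rewrite !natrD -(addn1 n) natrD; lra.
apply: le_trans xK; rewrite leeBrDr //.
apply: le_trans (leeD xG xH); rewrite -!EFinD lee_fin -(addn1 n) natrD; lra.
Qed.

Theorem theorem2p12 (R : realType) (s : nat) (t : R) (H : multigraph)
    (hs : (3 <= s)%N) (ht : 1 < t) (hH : s_graph s H)
    (hr : (2 < resistance H)%N)
    (hxi : ((t * ((resistance H)%:R - 2))%:E <= oddness R s H - 2%:E)%E) :
  ~ exists c : R, [/\ 1 <= c, c < t
      & forall G : multigraph, s_graph s G ->
          (oddness R s G <= (c * (resistance G)%:R)%:E)%E].
Proof.
case=> c [c1 ct bound].
set r : R := (resistance H)%:R.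
have r3 : 3 <= r by rewrite /r (ler_nat R 3).
have tr : 0 < t * (r - 2) by apply: mulr_gt0; lra.
(* Zero resistance would force the oddness to be at most 0 under the assumed bound. *)
have pos G : s_graph s G -> (0 < oddness R s G)%E -> (0 < resistance G)%N.
  move=> sG /lt_le_trans/(_ (bound G sG)); rewrite lte_fin lt0n.
  by apply: contraTneq => ->; rewrite mulr0 ltxx.
have xH : ((t * (r - 2) + 2)%:E <= oddness R s H)%E.
  by rewrite EFinD -leeBrDr.
have x2 : 2 < t * (r - 2) + 2 by lra.
(* Large enough that [n * (t - c)] exceeds [2 * c]. *)
pose n := (Num.bound (2 * c / (t - c))).+1.
have [G [sG rG xG]] := iterated_two_sum hs hH hr x2 xH pos n.
have := le_trans xG (bound G sG); rewrite lee_fin -/r in rG * => le1.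
have le2 : c * (resistance G)%:R <= c * (n%:R * (r - 2) + r) by apply: ler_wpM2l => //; lra.
have nb : 2 * c < n%:R * (t - c).
  rewrite -ltr_pdivrMr; last by lra.
  apply: lt_trans (archi_boundP _) _; last by rewrite ltr_nat.
  by apply: divr_ge0; lra.
(* The bounds combine to [(n + 1) * (t - c) * (r - 2) + 2 <= 2 * c]. Writing [r - 2] as
   [(r - 3) + 1] and dropping the nonnegative products with [r - 3] contradicts the choice of
   [n]. *)
have : 0 <= n%:R * (t - c) * (r - 3) by apply: mulr_ge0; lra.
have : 0 <= (t - c) * (r - 3) by apply: mulr_ge0; lra.
by lra.
Qed.
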